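(* There is an absolute constant $c>0$ such that for every integer $k$ with $n=2^k-1\geq 1$, each of the functions $\mathrm{Re}(P_k)$, $\mathrm{Re}(Q_k)$, $\mathrm{Im}(P_k)$, and $\mathrm{Im}(Q_k)$ has at least $cn$ zeros on the unit circle $\{z\in\mathbb{C}:|z|=1\}$.
   Context: The Rudin-Shapiro polynomials are defined recursively by $P_0(z):=1$, $Q_0(z):=1$, and $$P_{k+1}(z):=P_k(z)+z^{2^k}Q_k(z),\qquad Q_{k+1}(z):=P_k(z)-z^{2^k}Q_k(z),\qquad k=0,1,2,\ldots.$$ $\mathrm{Re}(P_k)$ denotes the function $z\mapsto\mathrm{Re}(P_k(z))$, and similarly for the others; here $n$ denotes $2^k-1$. *)

(* Defs.v *)
From mathcomp Require Import all_boot all_order all_algebra.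
From mathcomp Require Import reals complex.

Set Implicit Arguments.
Unset Strict Implicit.
Unset Printing Implicit Defensive.

Import Order.TTheory GRing.Theory Num.Theory.

Local Open Scope ring_scope.

Fixpoint rudin_shapiro (A : nzRingType) (k : nat) : {poly A} * {poly A} :=
  if k is j.+1 then
    let: (p, q) := rudin_shapiro A j in
    (p + 'X^(2 ^ j) * q, p - 'X^(2 ^ j) * q)
  else (1, 1).

Definition RS_P (A : nzRingType) (k : nat) : {poly A} := (rudin_shapiro A k).1.
Definition RS_Q (A : nzRingType) (k : nat) : {poly A} := (rudin_shapiro A k).2.

(* Zeros are counted without multiplicity.  The zero set of f is not assumed
   to be finite, hence the finite list of distinct zeros. *)
Definition has_at_least_unimodular_zeros (R : realType) (x : R)
    (f : R[i] -> R) : Prop :=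
  exists s : seq R[i],
    [/\ uniq s, forall z, z \in s -> `|z| = 1 /\ f z = 0 & x <= (size s)%:R].

(* Main.v *)
(* Let N = 2^k and M = 2N, so that |P_k|^2 <= M on the unit circle, and let f be
   the real or imaginary part of P_k or Q_k, sampled at the M-th roots of unity.
   Parseval gives a mean square of f of order N; as |f| <= sqrt M, the mean of
   |f| is at least of order sqrt N. On the other hand the sums of f over windows
   of L consecutive samples have mean square at most M L, so for a large absolute
   constant L they are on average much smaller than the corresponding sums
   of |f|. Hence f changes sign in a positive proportion of the windows, and a
   positive proportion of the M arcs between consecutive samples contains a zero.
   For the finitely many k with M too small compared with L, a single zero is
   enough, and it comes from the values at 1, -1 and i. *)
Require Import Defs.
From mathcomp Require Import all_boot all_order all_algebra.
From mathcomp Require Import reals complex.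
From mathcomp Require Import boolp classical_sets topology normedtype trigo.
From mathcomp Require Import ring lra.

Import Order.TTheory GRing.Theory Num.Theory numFieldNormedType.Exports.

Set Implicit Arguments.
Unset Strict Implicit.
Unset Printing Implicit Defensive.

Local Open Scope ring_scope.

(** * Sums over the powers of a primitive root of unity *)

(** Each monomial of degree strictly between 0 and [M] sums to zero, as a geometric series. Taken at
    the square of a polynomial, this compares the mean squares of its real and imaginary parts. *)
Lemma sum_prim_root_horner (F : fieldType) (M : nat) (w : F) (r : {poly F}) :
  M.-primitive_root w -> (size r <= M)%N ->
  \sum_(m < M) r.[w ^+ m] = M%:R * r`_0.
Proof.
move=> pw szr; have M0 := prim_order_gt0 pw.
under eq_bigr do rewrite (horner_coef_wide _ szr).
rewrite exchange_big/= (bigD1 (Ordinal M0))//= [X in _ + X]big1 ?addr0.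
  rewrite -mulr_sumr; under eq_bigr do rewrite expr0.
  by rewrite sumr_const card_ord mulrC.
move=> j j0; rewrite -mulr_sumr.
under eq_bigr do rewrite exprAC.
have wj1 : w ^+ j - 1 != 0.
  rewrite subr_eq0 -(prim_order_dvd pw); apply: contra j0 => Mj.
  by apply/eqP/val_inj/eqP => /=; rewrite -(modn_small (ltn_ord j)).
have /eqP := subrX1 (w ^+ j) M.
rewrite exprAC (prim_expr_order pw) expr1n subrr eq_sym mulf_eq0 (negPf wj1) /=.
by move=> /eqP ->; rewrite mulr0.
Qed.

Section Parseval.
Variables (C : numClosedFieldType) (M : nat) (w : C).
Hypothesis pw : M.-primitive_root w.

Let M_gt0 := prim_order_gt0 pw.

Lemma norm_prim_root : `|w| = 1.
Proof.
by apply/eqP; rewrite -(@pexpr_eq1 _ _ M)// -normrX (prim_expr_order pw) normr1.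
Qed.

Lemma parseval (c : nat -> C) :
  \sum_(m < M) `|\sum_(j < M) c j * w ^+ (j * m)| ^+ 2 =
    M%:R * \sum_(j < M) `|c j| ^+ 2.
Proof.
have w0 : w != 0 by rewrite -normr_eq0 norm_prim_root oner_neq0.
have wC : w^* = w^-1 by rewrite [RHS]invC_norm norm_prim_root expr1n invr1 mul1r.
transitivity (\sum_(j < M) \sum_(l < M) (c j * (c l)^* *
    \sum_(m < M) (w ^+ j / w ^+ l) ^+ m)).
  under eq_bigr do rewrite normCK rmorph_sum/= big_distrlr/=.
  rewrite exchange_big/=; apply: eq_bigr => j _.
  rewrite exchange_big/=; apply: eq_bigr => l _.
  rewrite mulr_sumr; apply: eq_bigr => m _.
  by rewrite rmorphM rmorphXn/= wC exprVn !exprM expr_div_n mulrACA.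
rewrite mulr_sumr; apply: eq_bigr => j _.
rewrite (bigD1 j)//= divff ?expf_neq0// [X in _ + X]big1 ?addr0.
  under eq_bigr do rewrite expr1n.
  by rewrite sumr_const card_ord mulrC normCK.
move=> l lj; set x := _ / _.
have x1 : x - 1 != 0.
  rewrite subr_eq0; apply: contra lj => /eqP x1.
  have /eqP : w ^+ j = w ^+ l by rewrite -[RHS]mul1r -x1 divfK ?expf_neq0.
  rewrite (eq_prim_root_expr pw) !modn_small// => /eqP jl.
  by apply/eqP/val_inj.
have /eqP := subrX1 x M.
rewrite expr_div_n !(exprAC w _ M) (prim_expr_order pw) !expr1n divr1 subrr.
by rewrite eq_sym mulf_eq0 (negPf x1) => /eqP ->; rewrite mulr0.
Qed.

Lemma parseval_horner (r : {poly C}) : (size r <= M)%N ->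
  \sum_(m < M) `|r.[w ^+ m]| ^+ 2 = M%:R * \sum_(j < M) `|r`_j| ^+ 2.
Proof.
move=> szr; rewrite -parseval; apply: eq_bigr => m _; congr (`|_| ^+ 2).
by rewrite (horner_coef_wide _ szr); apply: eq_bigr => j _; rewrite mulnC exprM.
Qed.

(* Parseval is applied twice: to the window sums, and to the Dirichlet kernels
   [\sum_(l < L) w ^+ (j * l)] that appear as their coefficients. *)
Lemma sum_window_sq (r : {poly C}) (L : nat) :
  (size r <= M)%N -> (L <= M)%N -> (forall j, `|r`_j| <= 1) ->
  \sum_(m < M) `|\sum_(l < L) r.[w ^+ (m + l)]| ^+ 2 <= M%:R * (M%:R * L%:R).
Proof.
move=> szr LM r1; pose D j := \sum_(l < L) w ^+ (j * l).
(* [D] is the discrete Fourier transform of the indicator of [l < L]. *)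
have sumD : \sum_(j < M) `|D j| ^+ 2 = M%:R * L%:R.
  transitivity (\sum_(j < M) `|\sum_(l < M) (l < L)%:R * w ^+ (l * j)| ^+ 2).
    apply: eq_bigr => j _; congr (`|_| ^+ 2).
    rewrite /D (big_ord_widen _ (fun l => w ^+ (j * l)) LM) big_mkcond/=.
    by apply: eq_bigr => l _; rewrite mulnC; case: ifP; rewrite (mul1r, mul0r).
  rewrite (parseval (fun l => (l < L)%:R)); congr (_ * _).
  transitivity (\sum_(l < M | (l < L)%N) (1 : C)).
    by rewrite [RHS]big_mkcond; apply: eq_bigr => l _; case: ifP;
      rewrite ?normr1 ?normr0 ?expr1n ?expr0n.
  by rewrite -(big_ord_widen _ (fun=> 1) LM) sumr_const card_ord.
rewrite -sumD.
have -> : \sum_(m < M) `|\sum_(l < L) r.[w ^+ (m + l)]| ^+ 2 =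
    \sum_(m < M) `|\sum_(j < M) (r`_j * D j) * w ^+ (j * m)| ^+ 2.
  apply: eq_bigr => m _; congr (`|_| ^+ 2).
  under eq_bigr do rewrite (horner_coef_wide _ szr).
  rewrite exchange_big/=; apply: eq_bigr => j _.
  rewrite -mulrA mulr_suml -mulr_sumr; congr (_ * _); apply: eq_bigr => l _.
  by rewrite -exprD -mulnDr -exprM mulnC addnC.
rewrite (parseval (fun j => r`_j * D j)) ler_wpM2l// ler_sum// => j _.
by rewrite normrM exprMn ler_piMl ?exprn_ge0 ?exprn_ile1.
Qed.

End Parseval.

(** * Angles on the unit circle *)

Section Cis.
Variable R : realType.
Implicit Types (s t : R) (p : {poly R[i]}).

Definition cis t : R[i] := Complex (cos t) (sin t).

Lemma cis0 : cis 0 = 1.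
Proof. by rewrite /cis cos0 sin0. Qed.

Lemma cisD s t : cis (s + t) = cis s * cis t.
Proof. by rewrite /cis cosD sinD; congr Complex; rewrite addrC. Qed.

Lemma cisMn t n : cis (t *+ n) = cis t ^+ n.
Proof. by elim: n => [|n IH]; rewrite ?cis0// mulrS cisD IH exprS. Qed.

Lemma norm_cis t : `|cis t| = 1.
Proof. by rewrite normc_def /= cos2Dsin2 sqrtr1. Qed.

Lemma cis_2pi : cis (pi *+ 2) = 1.
Proof. by rewrite /cis cos2pi sin2pi. Qed.

(** If [s < t], the half difference [x] lies strictly between 0 and [pi], where the sine is
    positive; but equal points give [cos (x *+ 2) = 1], hence [sin x = 0]. *)
Lemma cis_inj s t : 0 <= s < pi *+ 2 -> 0 <= t < pi *+ 2 -> cis s = cis t -> s = t.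
Proof.
wlog st : s t / s <= t => [H Hs Ht E|].
  by have /orP[st|ts] := le_total s t; [exact: H|exact/esym/H].
move=> /andP[s0 s2] /andP[t0 t2] [cst sst].
have [//|ts] := eqVneq s t.
have lst : s < t by rewrite lt_neqAle ts.
pose x := (t - s) / 2.
have : 0 < sin x by apply: sin_gt0_pi; rewrite /x; lra.
have : cos (x *+ 2) = 1.
  have -> : x *+ 2 = t - s by rewrite /x; lra.
  by rewrite cosB cst sst -!expr2 cos2Dsin2.
by rewrite cos_mulr2n cos2sin2; nra.
Qed.

(** Both parts go through one induction, because multiplication by [cis t] in the Horner step mixes
    them. *)
Lemma continuous_horner_cis p :
  continuous (fun t => complex.Re p.[cis t]) /\
  continuous (fun t => complex.Im p.[cis t]).
Proof.
elim/poly_ind: p => [|p [a b] [cRe cIm]].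
  by split=> t; under eq_fun do rewrite horner0 /=; exact: cvg_cst.
have E t : p.[cis t] = Complex (complex.Re p.[cis t]) (complex.Im p.[cis t]).
  by case: (p.[cis t]).
split=> t.
  under eq_fun do rewrite hornerMXaddC E /=.
  apply: cvgD; last exact: cvg_cst.
  by apply: cvgB; apply: cvgM; [exact: cRe|exact: continuous_cos|
    exact: cIm|exact: continuous_sin].
under eq_fun do rewrite hornerMXaddC E /=.
apply: cvgD; last exact: cvg_cst.
by apply: cvgD; apply: cvgM; [exact: cRe|exact: continuous_sin|
    exact: cIm|exact: continuous_cos].
Qed.

Lemma prim_root_cis (M : nat) : (0 < M)%N ->
  M.-primitive_root (cis (pi *+ 2 / M%:R)).
Proof.
move=> M0; rewrite /primitive_root_of_unity M0; apply/forallP => i; apply/eqP.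
have MR : 0 < M%:R :> R by rewrite ltr0n.
rewrite unity_rootE -cisMn; have [iM|iM] := eqVneq i.+1 M.
  by rewrite -[_ *+ i.+1]mulr_natr iM divfK ?cis_2pi ?eqxx// lt0r_neq0.
have ltiM : (i.+1 < M)%N by rewrite ltn_neqAle iM ltn_ord.
apply/negbTE/eqP; rewrite -cis0 => /cis_inj.
have tp : 0 < pi *+ 2 :> R by rewrite mulr2n addr_gt0 ?pi_gt0.
have x0 : 0 < (pi : R) *+ 2 / M%:R *+ i.+1 by rewrite pmulrn_lgt0 ?divr_gt0.
move=> E; move: (x0); rewrite E ?ltxx ?lexx//.
by rewrite ltW//= -[X in X < _]mulr_natr mulrAC ltr_pdivrMr// ltr_pM2l// ltr_nat.
Qed.

End Cis.

(** * Sign changes of samples and zeros in arcs *)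

Lemma sum_shift_mod (V : nmodType) (M l : nat) (F : nat -> V) : (0 < M)%N ->
  \sum_(m < M) F ((m + l) %% M)%N = \sum_(m < M) F m.
Proof.
move=> M0; pose h (m : 'I_M) := Ordinal (ltn_pmod (m + l) M0).
have hinj : injective h.
  move=> i j [/eqP]; rewrite eqn_modDr !modn_small// => /eqP ij.
  exact/val_inj.
by rewrite [RHS](reindex_inj hinj).
Qed.

Section Arcs.
Variables (R : realType) (p : {poly R[i]}) (M : nat).
Hypothesis M_gt0 : (0 < M)%N.

Let theta : R := pi *+ 2 / M%:R.
Let g (m : nat) : R := complex.Re p.[cis theta ^+ m].

(* Half-open arcs, so that zeros in distinct arcs are distinct. *)
Definition has_arc_zero (m : nat) : Prop :=
  exists t : R, theta *+ m <= t < theta *+ m.+1 /\ complex.Re p.[cis t] = 0.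

Definition zero_arcs : {set 'I_M} := [set i : 'I_M | `[< has_arc_zero i >]].

Let M_neq0 : M%:R != 0 :> R. Proof. by rewrite pnatr_eq0 -lt0n. Qed.

Let theta_gt0 : 0 < theta.
Proof. by rewrite divr_gt0 ?ltr0n// mulr2n addr_gt0 ?pi_gt0. Qed.

Let theta_ltS m : theta *+ m < theta *+ m.+1.
Proof. by rewrite mulrS ltrDr. Qed.

Let thetaM : theta *+ M = pi *+ 2.
Proof. by rewrite -[LHS]mulr_natr divfK. Qed.

(** Windows may run past the last sample, so arcs are indexed by all naturals; subtracting the whole
    turns [q] returns to an arc with index below [M]. *)
Lemma has_arc_zero_mod m : has_arc_zero m -> has_arc_zero (m %% M).
Proof.
move=> [t [/andP[t1 t2] pt]].
pose q := theta *+ (m %/ M * M).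
have Em : theta *+ m = q + theta *+ (m %% M) by rewrite -mulrnDr -divn_eq.
have cq : cis q = 1 by rewrite /q mulnC mulrnA thetaM cisMn cis_2pi expr1n.
exists (t - q); split; first by move: t1 t2; rewrite !mulrS Em; lra.
by rewrite -pt -[in RHS](subrK q t) (cisD (t - q)) cq mulr1.
Qed.

(** The intermediate value theorem works on a closed arc, and the zero it gives may be the right
    endpoint, which belongs to the next half-open arc. Hence two arcs are assumed free of zeros. *)
Lemma arc_sign m : ~ has_arc_zero m -> ~ has_arc_zero m.+1 -> 0 < g m * g m.+1.
Proof.
move=> nm nm1; rewrite ltNge; apply/negP => gm.
have le01 : theta *+ m <= theta *+ m.+1 by rewrite ltW ?theta_ltS.
have cf : {within `[theta *+ m, theta *+ m.+1],
    continuous (fun t => complex.Re p.[cis t])}%classic.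
  by apply: continuous_subspaceT; exact: (continuous_horner_cis p).1.
have [|c] := IVT le01 cf (v := 0).
  rewrite !cisMn -/(g m) -/(g m.+1) ge_min le_max.
  by have [|] := lerP (g m) 0; have [|] := lerP (g m.+1) 0 => /=; nra.
rewrite in_itv/= => /andP[c1 c2] pc.
move: c2; rewrite le_eqVlt => /orP[/eqP c2|c2].
  by apply: nm1; exists c; rewrite pc c2 lexx theta_ltS.
by apply: nm; exists c; rewrite pc c1 c2.
Qed.

Lemma arc_neq0 m : ~ has_arc_zero m -> g m != 0.
Proof.
move=> nm; apply/eqP => gm; apply: nm.
by exists (theta *+ m); rewrite lexx theta_ltS cisMn.
Qed.

(** By [arc_sign] the sign passes from each sample to the next, so every term has the sign of the
    first and nothing cancels. *)
Lemma norm_sum_window m L : (forall l, (l < L)%N -> ~ has_arc_zero (m + l)) ->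
  `|\sum_(l < L) g (m + l)| = \sum_(l < L) `|g (m + l)|.
Proof.
case: L => [|L] nz; first by rewrite !big_ord0 normr0.
have gm : g m != 0 by apply: arc_neq0; have := nz 0 isT; rewrite addn0.
have pos l : (l < L.+1)%N -> 0 < g m * g (m + l).
  elim: l => [_|l IH lL]; first by rewrite addn0 -expr2 exprn_even_gt0.
  have := IH (ltnW lL); have := @arc_sign (m + l) (nz _ (ltnW lL)).
  by rewrite -addnS => /(_ (nz _ lL)); nra.
have E (l : 'I_L.+1) : g (m + l) = Num.sg (g m) * `|g (m + l)|.
  have := pos l (ltn_ord l); move: gm; rewrite neq_lt => /orP[] g0 h.
    by rewrite ltr0_sg// ltr0_norm ?mulN1r ?opprK//; nra.
  by rewrite gtr0_sg// gtr0_norm ?mul1r//; nra.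
rewrite (eq_bigr _ (fun l _ => E l)) -mulr_sumr normrM normr_sg gm mul1r.
by rewrite ger0_norm ?sumr_ge0.
Qed.

Lemma has_at_least_zero_arcs :
  has_at_least_unimodular_zeros #|zero_arcs|%:R (fun z => complex.Re p.[z]).
Proof.
have arcP (i : 'I_M) : {t | i \in zero_arcs ->
    theta *+ i <= t < theta *+ i.+1 /\ complex.Re p.[cis t] = 0}.
  (* The angle 0 is a dummy value for arcs without a zero. *)
  have [|_] := boolP (i \in zero_arcs); last by exists 0.
  by rewrite inE => /asboolP /cid[t ht]; exists t.
pose tt i := sval (arcP i).
have ttP i : i \in zero_arcs ->
    theta *+ i <= tt i < theta *+ i.+1 /\ complex.Re p.[cis (tt i)] = 0.
  exact: svalP (arcP i).
exists [seq cis (tt i) | i <- enum zero_arcs]; split.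
- rewrite map_inj_in_uniq ?enum_uniq// => i j; rewrite !mem_enum => iZ jZ.
  have [/andP[i1 i2] _] := ttP _ iZ; have [/andP[j1 j2] _] := ttP _ jZ.
  have bnd (l : 'I_M) : 0 <= theta *+ l /\ theta *+ l.+1 <= pi *+ 2.
    split; first by rewrite mulrn_wge0 ?ltW.
    by rewrite -thetaM ler_pMn2l// leEnat ltn_ord.
  have [i0 iM] := bnd i; have [j0 jM] := bnd j.
  move=> /cis_inj E; have {}E : tt i = tt j.
    by apply: E; apply/andP; split;
      by [exact: le_trans i1|exact: le_trans j1|exact: lt_le_trans iM|exact: lt_le_trans jM].
  have : theta *+ i < theta *+ j.+1 by rewrite (le_lt_trans i1)// E.
  have : theta *+ j < theta *+ i.+1 by rewrite (le_lt_trans j1)// -E.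
  by rewrite !ltr_pMn2l// !ltnS => ? ?; apply/val_inj/eqP; rewrite eqn_leq; apply/andP.
- move=> z zs; case: (mapP zs) => i; rewrite mem_enum => iZ ->.
  by rewrite norm_cis; have [] := ttP _ iZ.
- by rewrite size_map -cardE.
Qed.

(** In a window that meets no zero arc the two sums agree, by [norm_sum_window]. Any other window
    costs at most [L%:R * B], and since each zero arc lies in [L] windows, there are at most
    [L * #|zero_arcs|] of these. *)
Lemma sum_windows_le (L : nat) (B : R) : (forall m, `|g m| <= B) ->
  L%:R * \sum_(m < M) `|g m| <=
    \sum_(m < M) `|\sum_(l < L) g (m + l)| + L%:R * B * (L%:R * #|zero_arcs|%:R).
Proof.
move=> gB.
have gmod m : g (m %% M) = g m by rewrite /g (prim_expr_mod (prim_root_cis _ _)).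
pose I (m : nat) : R := `[< has_arc_zero m >]%:R.
have B0 : 0 <= B := le_trans (normr_ge0 _) (gB 0).
have I0 m : 0 <= I m by rewrite /I ler0n.
have -> : L%:R * \sum_(m < M) `|g m| = \sum_(m < M) \sum_(l < L) `|g (m + l)|.
  have E l : \sum_(m < M) `|g (m + l)| = \sum_(m < M) `|g m|.
    rewrite -(sum_shift_mod l (fun m => `|g m|) M_gt0).
    by apply: eq_bigr => m _; rewrite gmod.
  rewrite exchange_big/= (eq_bigr _ (fun l _ => E (nat_of_ord l))).
  by rewrite sumr_const card_ord mulr_natl.
have -> : L%:R * #|zero_arcs|%:R =
    \sum_(m < M) \sum_(l < L) I ((m + l) %% M)%N.
  have E l : \sum_(m < M) I ((m + l) %% M)%N = #|zero_arcs|%:R.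
    rewrite (sum_shift_mod l I M_gt0) -sum1_card natr_sum [RHS]big_mkcond/=.
    by apply: eq_bigr => m _; rewrite inE /I; case: asboolP.
  rewrite exchange_big/= (eq_bigr _ (fun l _ => E (nat_of_ord l))).
  by rewrite sumr_const card_ord mulr_natl.
rewrite mulr_sumr -big_split/= ler_sum// => m _.
have [nz|/existsNP[l /not_implyP[lL /contrapT lz]]] :=
  pselect (forall l, (l < L)%N -> ~ has_arc_zero (m + l)).
  by rewrite norm_sum_window// lerDl mulr_ge0 ?mulr_ge0 ?sumr_ge0.
apply: (@le_trans _ _ (L%:R * B)).
  apply: (@le_trans _ _ (\sum_(l < L) B)); first exact: ler_sum.
  by rewrite sumr_const card_ord mulr_natl.
apply: (@le_trans _ _ (L%:R * B * 1)); first by rewrite mulr1.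
(* The arc at position [l] in the window alone contributes 1 to the sum of indicators. *)
apply: (@le_trans _ _ (L%:R * B * \sum_(l < L) I ((m + l) %% M)%N)).
  rewrite ler_wpM2l ?mulr_ge0// (bigD1 (Ordinal lL))//=.
  rewrite {1}/I asboolT; last exact: has_arc_zero_mod.
  by rewrite lerDl sumr_ge0.
by rewrite lerDr.
Qed.

End Arcs.

(** * The lower bound for the number of zero arcs *)

Lemma Re_sum (R : realType) (I : Type) (s : seq I) (F : I -> R[i]) :
  complex.Re (\sum_(i <- s) F i) = \sum_(i <- s) complex.Re (F i).
Proof. by apply: (big_morph (@complex.Re R)) => // -[a b] [c d]. Qed.

Lemma Re_natM (R : realType) (n : nat) (z : R[i]) :
  complex.Re (n%:R * z) = n%:R * complex.Re z.
Proof. by rewrite -(rmorph_nat (real_complex R)) /=; case: z => a b /=; ring. Qed.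

Lemma normc_sq (R : realType) (z : R[i]) :
  complex.Re (`|z| ^+ 2) = complex.Re z ^+ 2 + complex.Im z ^+ 2.
Proof. by rewrite -add_Re2_Im2. Qed.

Lemma zero_arcs_lower (R : realType) (p : {poly R[i]}) (N : nat) :
  (128 <= N)%N -> (size p <= N)%N ->
  (forall j, (j < N)%N -> `|p`_j| = 1) ->
  (forall z, `|z| = 1 -> `|p.[z]| ^+ 2 <= (2 * N)%:R) ->
  -1 <= complex.Re (p`_0 ^+ 2) ->
  (2 * N)%:R <= 16 * 256 * #|zero_arcs p (2 * N)|%:R :> R.
Proof.
move=> N128 szp p1 pB p0; set M := (2 * N)%N.
have N0 : (0 < N)%N by apply: leq_trans N128.
have M0 : (0 < M)%N by rewrite muln_gt0.
have NM : (N <= M)%N by rewrite leq_pmull.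
pose w : R[i] := cis (pi *+ 2 / M%:R).
have pw : M.-primitive_root w := prim_root_cis R M0.
have wn m : `|w ^+ m| = 1 by rewrite normrX norm_cis expr1n.
pose g m := complex.Re p.[w ^+ m].
pose B : R := Num.sqrt M%:R.
have B2 : B ^+ 2 = M%:R by rewrite sqr_sqrtr.
have B0 : 0 < B by rewrite sqrtr_gt0 ltr0n.
have pB' m : complex.Re p.[w ^+ m] ^+ 2 + complex.Im p.[w ^+ m] ^+ 2 <= B ^+ 2.
  rewrite B2 -normc_sq; have := pB _ (wn m).
  by rewrite -/M -(rmorph_nat (real_complex R)) lecE /= => /andP[].
have gB m : `|g m| <= B.
  by have := pB' m; rewrite -/(g m) ler_norml; nra.
have sum1 : \sum_(m < M)
    (complex.Re p.[w ^+ m] ^+ 2 + complex.Im p.[w ^+ m] ^+ 2) = M%:R * N%:R.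
  have := congr1 (@complex.Re R) (parseval_horner pw (leq_trans szp NM)).
  rewrite Re_sum Re_natM Re_sum => E.
  under eq_bigr do rewrite -normc_sq; rewrite {}E; congr (_ * _).
  transitivity (\sum_(j < M | (j < N)%N) (1 : R)); last first.
    by rewrite -(big_ord_widen _ (fun=> 1) NM) sumr_const card_ord.
  rewrite [RHS]big_mkcond; apply: eq_bigr => j _.
  have [jN|Nj] := ltnP j N; first by rewrite p1// expr1n.
  by rewrite nth_default ?(leq_trans szp)// normr0 expr0n.
have sum2 : \sum_(m < M)
    (complex.Re p.[w ^+ m] ^+ 2 - complex.Im p.[w ^+ m] ^+ 2) >= - M%:R.
  (* This is why [2 * N] samples are taken: [p ^+ 2] must have degree below [M]. *)
  have szp2 : (size (p ^+ 2) <= M)%N.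
    rewrite expr2 (leq_trans (size_polyMleq _ _))// /M mul2n -addnn.
    by rewrite (leq_trans (leq_pred _))// leq_add.
  have := congr1 (@complex.Re R) (sum_prim_root_horner pw szp2).
  rewrite Re_sum Re_natM => E.
  have {}E : \sum_(m < M)
      (complex.Re p.[w ^+ m] ^+ 2 - complex.Im p.[w ^+ m] ^+ 2) =
      M%:R * complex.Re (p`_0 ^+ 2).
    transitivity (M%:R * complex.Re (p ^+ 2)`_0).
      rewrite -E; apply: eq_bigr => m _; rewrite horner_exp.
      by case: (p.[w ^+ m]) => a b; rewrite !expr2.
    by rewrite -!horner_coef0 horner_exp.
  by rewrite E -[X in X <= _]mulr1 mulNr -mulrN ler_wpM2l.
(* Adding [sum1] and [sum2] gives twice the sum of [g m ^+ 2], which is thus at least M(N - 1)/2,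
   while the left side is 2MN; the factor 8 leaves room to absorb the -1. *)
have energy : M%:R * B ^+ 2 <= 8 * \sum_(m < M) g m ^+ 2.
  have Ng : (128 : R) <= N%:R by rewrite ler_nat.
  have M1 : 1 <= M%:R :> R by rewrite ler1n.
  have MN : M%:R = 2 * N%:R :> R by rewrite /M natrM.
  have := lerD (lexx (M%:R * N%:R)) sum2; rewrite -{2}sum1 -big_split/=.
  rewrite (eq_bigr (fun m : 'I_M => 2 * g m ^+ 2)); last by move=> m _; rewrite /g; ring.
  by rewrite -mulr_sumr B2; nra.
have L1 : M%:R * B <= 8 * \sum_(m < M) `|g m|.
  rewrite -(ler_pM2r B0) -mulrA -expr2 (le_trans energy)// -mulrA ler_wpM2l//.
  rewrite mulr_suml ler_sum// => m _.
  by rewrite -real_normK ?num_real// expr2 ler_wpM2l.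
(* The existential keeps [L] opaque. With 256, the bound 16 M B for the window sums is half of the
   lower bound (256/8) M B = 32 M B for the sums of absolute values; [128 <= N] ensures [L <= M]. *)
have [L EL] : exists L, L = 256%N by exists 256%N.
have LR : L%:R = 256 :> R by rewrite EL.
pose W (m : nat) := \sum_(l < L) g (m + l)%N.
have window : \sum_(m < M) W m ^+ 2 <= M%:R * (B ^+ 2 * L%:R).
  have pc j : `|p`_j| <= 1.
    have [jN|Nj] := ltnP j N; first by rewrite p1.
    by rewrite nth_default ?(leq_trans szp)// normr0.
  have LM : (L <= M)%N by rewrite EL /M (@leq_mul 2 128).
  have := sum_window_sq pw (leq_trans szp NM) LM pc.
  rewrite lecE => /andP[_]; rewrite Re_sum !Re_natM B2 => h.
  apply: le_trans (le_trans h _); last first.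
    by rewrite -(rmorph_nat (real_complex R)).
  apply: ler_sum => m _; rewrite normc_sq Re_sum.
  by rewrite -[X in X <= _]addr0 lerD2l sqr_ge0.
(* AM-GM: [32 |W| B <= W^2 + (16 B)^2], where [16^2 = L] *)
have absW : \sum_(m < M) `|W m| <= 16 * (M%:R * B).
  rewrite -(ler_pM2r B0) -(ler_pM2l (ltr0n _ 32)).
  apply: (@le_trans _ _ (\sum_(m < M) (W m ^+ 2 + 256 * B ^+ 2))).
    rewrite mulr_suml mulr_sumr ler_sum// => m _.
    by rewrite -(real_normK (num_real (W m))); have := sqr_ge0 (`|W m| - 16 * B); lra.
  rewrite big_split/= sumr_const card_ord -[_ *+ M]mulr_natl; rewrite LR in window; lra.
(* With Z zero arcs, 32 M B <= 16 M B + 256^2 B Z, and 256^2 / 16 = 16 * 256. *)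
have := le_trans (sum_windows_le M0 L gB) (lerD absW (lexx _)); rewrite LR => h.
have : M%:R * B <= 16 * 256 * #|zero_arcs p M|%:R * B by lra.
by rewrite ler_pM2r.
Qed.

(** * Coefficients and values of the Rudin-Shapiro polynomials *)

Section RudinShapiro.
Variable A : nzRingType.

Lemma RS_PS k : RS_P A k.+1 = RS_P A k + 'X^(2 ^ k) * RS_Q A k.
Proof. by rewrite /RS_P /RS_Q /=; case: rudin_shapiro. Qed.

Lemma RS_QS k : RS_Q A k.+1 = RS_P A k - 'X^(2 ^ k) * RS_Q A k.
Proof. by rewrite /RS_P /RS_Q /=; case: rudin_shapiro. Qed.

Lemma size_RS k : (size (RS_P A k) <= 2 ^ k)%N /\ (size (RS_Q A k) <= 2 ^ k)%N.
Proof.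
elim: k => [|k [IHp IHq]]; first by rewrite /RS_P /RS_Q /= size_poly1.
have sX : (size ('X^(2 ^ k) * RS_Q A k : {poly A})%R <= 2 ^ k.+1)%N.
  by rewrite (leq_trans (size_polyMleq _ _))// size_polyXn /= expnS mul2n -addnn leq_add2l.
have sP : (size (RS_P A k) <= 2 ^ k.+1)%N by rewrite (leq_trans IHp)// leq_exp2l.
rewrite RS_PS RS_QS; split; rewrite (leq_trans (size_polyD _ _))// geq_max sP//.
by rewrite size_polyN.
Qed.

Lemma coef_RS k j : (j < 2 ^ k)%N ->
  ((RS_P A k)`_j = 1 \/ (RS_P A k)`_j = -1) /\
  ((RS_Q A k)`_j = 1 \/ (RS_Q A k)`_j = -1).
Proof.
elim: k j => [|k IH] j.
  by rewrite expn0 ltnS leqn0 => /eqP ->; rewrite /RS_P /RS_Q /= coefC; split; left.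
rewrite RS_PS RS_QS coefB coefD coefXnM => jk.
have [jlt|jge] := ltnP j (2 ^ k); first by rewrite addr0 subr0; have [] := IH j jlt.
(* The two summands occupy disjoint blocks of degrees, so in the upper block only the shifted [RS_Q]
   is left. *)
rewrite nth_default ?(leq_trans (size_RS k).1)// !add0r.
have [|_ h] := IH (j - 2 ^ k)%N.
  by rewrite ltn_subLR// addnn -mul2n -expnS.
by split=> //; case: h => ->; [right|left; rewrite opprK].
Qed.

Lemma coef0_RS k : (RS_P A k)`_0 = 1 /\ (RS_Q A k)`_0 = 1.
Proof.
elim: k => [|k [IHp IHq]]; first by rewrite /RS_P /RS_Q /= coefC.
by rewrite RS_PS RS_QS coefB coefD coefXnM expn_gt0/= addr0 subr0.
Qed.

End RudinShapiro.

(** This is the parallelogram law for u + xv and u - xv with |x| = 1: each step of the recursion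
    doubles the sum of squares. *)
Lemma RS_norm (C : numClosedFieldType) k (z : C) : `|z| = 1 ->
  `|(RS_P C k).[z]| ^+ 2 + `|(RS_Q C k).[z]| ^+ 2 = (2 * 2 ^ k)%:R.
Proof.
move=> z1; elim: k => [|k IH].
  by rewrite /RS_P /RS_Q /= hornerC normr1 expr1n.
rewrite RS_PS RS_QS !hornerE ?hornerXn.
set u := (RS_P C k).[z] in IH *; set v := (RS_Q C k).[z] in IH *.
have xn : `|z ^+ (2 ^ k)| = 1 by rewrite normrX z1 expr1n.
move: xn; set x := z ^+ _ => xn.
have xv : `|x * v| ^+ 2 = `|v| ^+ 2 by rewrite normrM xn mul1r.
rewrite expnS natrM -IH -xv !normCK !(rmorphD, rmorphB, rmorphN)/=; ring.
Qed.

(** From index 2 on, the power of [z] in the recursion is 1, so a step maps (P, Q) to (P + Q, P -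
    Q), and two steps multiply both by 2. *)
Lemma RS_four_torsion (C : comNzRingType) (z : C) j : z ^+ 4 = 1 ->
  (RS_P C j.*2.+2).[z] = 2 ^+ j * (1 + z + z ^+ 2 - z ^+ 3) /\
  (RS_Q C j.*2.+2).[z] = 2 ^+ j * (1 + z - z ^+ 2 + z ^+ 3).
Proof.
move=> z4; elim: j => [|j [IHp IHq]].
  rewrite double0 !(RS_PS, RS_QS) /RS_P /RS_Q /= !hornerE ?hornerXn /=.
  by rewrite !expr2 /=; split; ring.
have zk n : z ^+ (2 ^ n.+2) = 1 by rewrite !expnS mulnA exprM z4 expr1n.
rewrite doubleS (RS_PS _ j.*2.+3) (RS_QS _ j.*2.+3).
rewrite (RS_PS _ j.*2.+2) (RS_QS _ j.*2.+2) !hornerE ?hornerXn !zk IHp IHq !exprS.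
by split; ring.
Qed.

(** * Zeros of the real and imaginary parts *)

Section Zeros.
Variable R : realType.
Implicit Types (f : R[i] -> R) (p : {poly R[i]}).

Lemma has_at_least_le (x y : R) f g : f =1 g -> x <= y ->
  has_at_least_unimodular_zeros y f -> has_at_least_unimodular_zeros x g.
Proof.
move=> fg xy [s [us sf ys]]; exists s; split=> // [z zs|].
  by rewrite -fg; exact: sf.
exact: le_trans ys.
Qed.

Lemma has_at_least_one f (z : R[i]) : `|z| = 1 -> f z = 0 ->
  has_at_least_unimodular_zeros 1 f.
Proof. by move=> z1 fz; exists [:: z]; split=> // _ /[!inE] /eqP ->. Qed.

Lemma zeros_unimodular_poly p (N : nat) :
  (128 <= N)%N -> (size p <= N)%N ->
  (forall j, (j < N)%N -> `|p`_j| = 1) ->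
  (forall z, `|z| = 1 -> `|p.[z]| ^+ 2 <= (2 * N)%:R) ->
  -1 <= complex.Re (p`_0 ^+ 2) ->
  has_at_least_unimodular_zeros (N%:R / (8 * 256)) (fun z => complex.Re p.[z]).
Proof.
move=> N128 szp p1 pB p0.
have M0 : (0 < 2 * N)%N by rewrite muln_gt0 (leq_trans _ N128).
apply: has_at_least_le (has_at_least_zero_arcs p M0) => //.
by have := zero_arcs_lower N128 szp p1 pB p0; rewrite natrM; lra.
Qed.

Lemma norm_ImaginaryN : `|- 'i%C : R[i]| = 1.
Proof. by rewrite normrN normc_def /= expr0n expr1n add0r sqrtr1. Qed.

Lemma zeros_pm1_poly p (N : nat) :
  (128 <= N)%N -> (size p <= N)%N ->
  (forall j, (j < N)%N -> p`_j = 1 \/ p`_j = -1) -> p`_0 = 1 ->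
  (forall z, `|z| = 1 -> `|p.[z]| ^+ 2 <= (2 * N)%:R) ->
  has_at_least_unimodular_zeros (N%:R / (8 * 256)) (fun z => complex.Re p.[z]) /\
  has_at_least_unimodular_zeros (N%:R / (8 * 256)) (fun z => complex.Im p.[z]).
Proof.
move=> N128 szp pm p0 pB.
have p1 j : (j < N)%N -> `|p`_j| = 1.
  by move=> /pm[] ->; rewrite ?normrN normr1.
split.
  by apply: zeros_unimodular_poly => //; rewrite p0 expr1n /=; lra.
(* Im p = Re (- i p) *)
pose q := (- 'i%C : R[i]) *: p.
have qE z : complex.Re q.[z] = complex.Im p.[z].
  by rewrite hornerZ; case: (p.[z]) => a b /=; ring.
apply: (has_at_least_le qE (lexx _)); apply: zeros_unimodular_poly => //.
- by rewrite (leq_trans (size_scale_leq _ _)).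
- by move=> j jN; rewrite coefZ normrM norm_ImaginaryN mul1r p1.
- by move=> z z1; rewrite hornerZ normrM norm_ImaginaryN mul1r pB.
- by rewrite coefZ p0 mulr1 sqrrN sqr_i.
Qed.

(** The coefficients are real, so the point 1 is a zero of both imaginary parts; this serves the
    small [k]. *)
Lemma RS_Im1 k : complex.Im (RS_P R[i] k).[1] = 0 /\ complex.Im (RS_Q R[i] k).[1] = 0.
Proof.
elim: k => [|k [IHp IHq]]; first by rewrite /RS_P /RS_Q /= hornerC.
rewrite RS_PS RS_QS !hornerE ?hornerXn expr1n mul1r.
move: IHp IHq; case: (RS_P _ k).[1] => a b; case: (RS_Q _ k).[1] => c d /= -> ->.
by rewrite addr0 subr0.
Qed.

Lemma RS_one_zero k : (0 < k)%N ->
  [/\ has_at_least_unimodular_zeros 1 (fun z : R[i] => complex.Re (RS_P R[i] k).[z]),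
     has_at_least_unimodular_zeros 1 (fun z : R[i] => complex.Re (RS_Q R[i] k).[z]),
     has_at_least_unimodular_zeros 1 (fun z : R[i] => complex.Im (RS_P R[i] k).[z])
   & has_at_least_unimodular_zeros 1 (fun z : R[i] => complex.Im (RS_Q R[i] k).[z])].
Proof.
move=> k0; have [i1 i2] := RS_Im1 k.
have n1 : `|1 : R[i]| = 1 := normr1 _.
suff [h1 h2] : has_at_least_unimodular_zeros 1 (fun z : R[i] => complex.Re (RS_P R[i] k).[z]) /\
     has_at_least_unimodular_zeros 1 (fun z : R[i] => complex.Re (RS_Q R[i] k).[z]).
  by split=> //; [exact: has_at_least_one n1 i1|exact: has_at_least_one n1 i2].
have nN1 : `|-1 : R[i]| = 1 by rewrite normrN normr1.
have one4 : (1 : R[i]) ^+ 4 = 1 by rewrite expr1n.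
have N14 : (-1 : R[i]) ^+ 4 = 1 by rewrite -signr_odd.
have pow2 (j : nat) : (2 ^+ j : R[i]) = (2 ^+ j)%:C%C by rewrite rmorphXn/= rmorph_nat.
(* For index 1 the polynomials are 1 + z and 1 - z, with zeros at -1 and 1. *)
case: k k0 {i1 i2} => [//|[_|k _]].
  rewrite RS_PS RS_QS /RS_P /RS_Q /=; split.
    by apply: (has_at_least_one nN1); rewrite !hornerE /= ?expr1 subrr.
  by apply: (has_at_least_one n1); rewrite !hornerE /= ?expr1 subrr.
rewrite -[k]odd_double_half; case: (odd k); rewrite ?add1n ?add0n.
  (* Odd index from 3 on: at the preceding even index P and Q are opposite at -1 and equal at 1, so
     the new P vanishes at -1 and the new Q at 1. *)
  have [P1 Q1] := RS_four_torsion k./2 one4.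
  have [PN QN] := RS_four_torsion k./2 N14.
  rewrite (RS_PS _ _.+2) (RS_QS _ _.+2); split.
    apply: (has_at_least_one nN1); rewrite !hornerE ?hornerXn expnS exprM sqrrN !expr1n.
    by rewrite mul1r PN QN pow2 -mulrDr !exprS expr0 /=; ring.
  apply: (has_at_least_one n1); rewrite !hornerE ?hornerXn !expr1n mul1r P1 Q1.
  by rewrite !expr1n pow2 -mulrBr /=; ring.
(* Even index: P takes a purely imaginary value at ['i]. *)
set m := k./2; split.
  have ni : `|'i%C : R[i]| = 1 by rewrite -normrN norm_ImaginaryN.
  apply: (has_at_least_one ni).
  have i4 : ('i%C : R[i]) ^+ 4 = 1 by rewrite (exprM _ 2 2) sqr_i sqrrN expr1n.
  by rewrite (RS_four_torsion m i4).1 pow2 !exprS expr0 /=; ring.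
(* For Q the values at 1 and -1 are real of opposite signs, so its real part has a zero on the upper
   half circle. *)
have [_ Q1] := RS_four_torsion m one4.
have [_ QN] := RS_four_torsion m N14.
have cf : {within `[0, pi],
    continuous (fun t => complex.Re (RS_Q R[i] m.*2.+2).[cis t])}%classic.
  by apply: continuous_subspaceT; exact: (continuous_horner_cis _).1.
have m2 : 0 < 2 ^+ m :> R by rewrite exprn_gt0.
have [|c _ Qc] := IVT (pi_ge0 R) cf (v := 0).
  have -> : cis (pi : R) = -1 by rewrite /cis cospi sinpi; apply/eqP; rewrite eq_complex /= oppr0 !eqxx.
  rewrite cis0 Q1 QN pow2 ge_min le_max !exprS expr0 /=.
  by apply/andP; split; apply/orP; [right|left]; lra.
exact: has_at_least_one (norm_cis c) Qc.
Qed.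

Lemma RS_many_zeros k : (7 <= k)%N ->
  [/\ has_at_least_unimodular_zeros ((2 ^ k)%:R / (8 * 256))
        (fun z : R[i] => complex.Re (RS_P R[i] k).[z]),
     has_at_least_unimodular_zeros ((2 ^ k)%:R / (8 * 256))
        (fun z : R[i] => complex.Re (RS_Q R[i] k).[z]),
     has_at_least_unimodular_zeros ((2 ^ k)%:R / (8 * 256))
        (fun z : R[i] => complex.Im (RS_P R[i] k).[z])
   & has_at_least_unimodular_zeros ((2 ^ k)%:R / (8 * 256))
        (fun z : R[i] => complex.Im (RS_Q R[i] k).[z])].
Proof.
move=> k7; have N128 : (128 <= 2 ^ k)%N by rewrite (@leq_exp2l 2 7).
have [sP sQ] := size_RS R[i] k; have [P0 Q0] := coef0_RS R[i] k.
have nP (z : R[i]) : `|z| = 1 -> `|(RS_P R[i] k).[z]| ^+ 2 <= (2 * 2 ^ k)%:R.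
  by move=> z1; rewrite -(RS_norm k z1) lerDl exprn_ge0.
have nQ (z : R[i]) : `|z| = 1 -> `|(RS_Q R[i] k).[z]| ^+ 2 <= (2 * 2 ^ k)%:R.
  by move=> z1; rewrite -(RS_norm k z1) lerDr exprn_ge0.
have [h1 h3] := zeros_pm1_poly N128 sP (fun j jk => (coef_RS R[i] jk).1) P0 nP.
by have [h2 h4] := zeros_pm1_poly N128 sQ (fun j jk => (coef_RS R[i] jk).2) Q0 nQ.
Qed.

End Zeros.

Theorem theorem2p3 (R : realType) :
  exists c : R, 0 < c /\
    forall k n : nat, n = (2 ^ k - 1)%N -> (1 <= n)%N ->
      [/\ has_at_least_unimodular_zeros (c * n%:R)
            (fun z : R[i] => complex.Re (RS_P R[i] k).[z]),
          has_at_least_unimodular_zeros (c * n%:R)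
            (fun z : R[i] => complex.Re (RS_Q R[i] k).[z]),
          has_at_least_unimodular_zeros (c * n%:R)
            (fun z : R[i] => complex.Im (RS_P R[i] k).[z])
        & has_at_least_unimodular_zeros (c * n%:R)
            (fun z : R[i] => complex.Im (RS_Q R[i] k).[z])].
Proof.
(* This is the constant of [RS_many_zeros], where the count is relative to 2^k, which exceeds
   [n]. *)
exists (8 * 256)^-1; split; first by rewrite invr_gt0; lra.
move=> k _ -> n1.
have [k7|k7] := leqP 7 k.
  have [h1 h2 h3 h4] := RS_many_zeros R k7.
  have le : (8 * 256)^-1 * (2 ^ k - 1)%:R <= (2 ^ k)%:R / (8 * 256) :> R.
    by rewrite [leRHS]mulrC ler_wpM2l ?ler_nat ?leq_subr// invr_ge0; lra.
  by split; [move: h1|move: h2|move: h3|move: h4]; exact: has_at_least_le.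
have k0 : (0 < k)%N by case: k n1 {k7}.
have [h1 h2 h3 h4] := RS_one_zero R k0.
(* For [k < 7], [n] is below 2^7, far less than 8 * 256, so a single zero is enough. *)
have le : (8 * 256)^-1 * (2 ^ k - 1)%:R <= 1 :> R.
  have : (2 ^ k - 1)%:R <= (2 ^ 7)%:R :> R.
    by rewrite ler_nat (leq_trans (leq_subr _ _))// leq_exp2l// ltnW.
  by rewrite natrX; lra.
by split; [move: h1|move: h2|move: h3|move: h4]; exact: has_at_least_le.
Qed.
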